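(* Let $n>3$ and let $a\neq b$ be digits in $\{1,3,7,9\}$. If $B_n(a,b)$ is an absolute prime, then $(a,b)\notin\{(9,7),(9,1),(1,7),(7,1),(3,9),(9,3)\}$.
   Context: For a positive integer $N$ with decimal representation $d_1d_2\dots d_n$ (digits $d_k\in\{0,\dots,9\}$, $d_1\neq 0$), a permutation of the digits of $N$ is any integer $\sum_{k=1}^{n} d_{\sigma(k)}10^{n-k}$ with $\sigma$ a permutation of $\{1,\dots,n\}$. $N$ is called an absolute prime if every integer obtained by a permutation of the digits of $N$ (including $N$ itself) is prime. The repunit $A_n=(10^n-1)/9$. For digits $a,b$ and $n\ge 1$, $B_n(a,b)=a\cdot A_n+(b-a)$ is the $n$-digit integer whose first $n-1$ digits are $a$ and whose last digit is $b$. *)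

(* Defs.v *)
From mathcomp Require Import all_boot.
Set Implicit Arguments. Unset Strict Implicit. Unset Printing Implicit Defensive.

(* little-endian decimal digits of n (fuel argument; fuel n suffices) *)
Fixpoint digits_le_aux (fuel n : nat) : seq nat :=
  match fuel with
  | 0 => [::]
  | f.+1 => if n == 0 then [::] else n %% 10 :: digits_le_aux f (n %/ 10)
  end.

Definition decimal_digits (N : nat) : seq nat := rev (digits_le_aux N N).

Definition num_of_digits (s : seq nat) : nat :=
  foldl (fun acc d => acc * 10 + d) 0 s.

(* N is an absolute prime: N positive and every integer obtained by
   permuting its decimal digits (leading zeros allowed) is prime. *)
Definition absolute_prime (N : nat) : Prop :=
  0 < N /\ forall s : seq nat, perm_eq s (decimal_digits N) -> prime (num_of_digits s).

Definition repunit (n : nat) : nat := (10 ^ n - 1) %/ 9.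

(* B_n(a,b) = a*A_n + (b - a); for n >= 1, a*A_n >= a so nat subtraction is exact *)
Definition B (n a b : nat) : nat := a * repunit n + b - a.

Example B_test : B 4 9 7 = 9997. Proof. by []. Qed.
Example dig_test : decimal_digits 1203 = [:: 1; 2; 0; 3]. Proof. by []. Qed.
Example num_test : num_of_digits [:: 0; 2; 1; 3] = 213. Proof. by []. Qed.

(* Main.v *)
Require Import Defs.
From mathcomp Require Import all_boot zify.

Set Implicit Arguments. Unset Strict Implicit. Unset Printing Implicit Defensive.

(** Moving the odd digit to position [k] shows that every
    [a * A_n + (b - a) * 10 ^ k] with [k < n] must be prime, so each pair is
    excluded by a divisor at a well-chosen [k].  The digits 3 and 9 are
    multiples of 3.  For (1,7), (9,7) and (7,1), 10 is a primitive root modulo 7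
    and 19, so some [k] gives a multiple of 7, respectively 19, when [n] is not a
    multiple of 3 (the [n] below 6, respectively 18, need other small primes); but
    if [3 %| n] then (1,7) and (7,1) have digit sum divisible by 3.  For (9,1),
    odd [n] is excluded modulo 7, and [10 ^ n - 9] is a difference of squares
    when [n] is even.  For (9,7) with [3 %| n], let [k] be the largest power of 2
    dividing [n]: then [n / k] is odd and greater than 1, so [10 ^ k + 1] is a
    proper divisor of [10 ^ n - 1 - 2 * 10 ^ k =
    (10 ^ n + 1) - 2 * (10 ^ k + 1)]. *)

(** * Digit strings and their values *)

Lemma num_of_digits_rcons s d :
  num_of_digits (rcons s d) = num_of_digits s * 10 + d.
Proof. by rewrite /num_of_digits foldl_rcons. Qed.

Lemma num_of_digits_cat s t :
  num_of_digits (s ++ t) = num_of_digits s * 10 ^ size t + num_of_digits t.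
Proof.
elim/last_ind: t => [|t d IHt]; first by rewrite cats0 muln1 addn0.
by rewrite -rcons_cat !num_of_digits_rcons IHt size_rcons expnS; lia.
Qed.

Lemma num_of_digits_gt0 s : s != [::] -> head 1 s != 0 -> 0 < num_of_digits s.
Proof.
elim/last_ind: s => // -[|x s] d IHs _; first by rewrite lt0n.
by move=> x_neq0; rewrite num_of_digits_rcons addn_gt0 muln_gt0 IHs.
Qed.

(** The default [1] of [head] lets the empty string pass the leading-zero test, so that the
    induction can strip last digits down to nothing. *)
Lemma digits_le_aux_num_of_digits fuel s :
  all (gtn 10) s -> head 1 s != 0 -> num_of_digits s <= fuel ->
  digits_le_aux fuel (num_of_digits s) = rev s.
Proof.
elim/last_ind: s fuel => [|s d IHs] fuel; first by case: fuel.
rewrite all_rcons => /andP[/= d_lt10 s_lt10] head_neq0.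
have num_gt0 : 0 < num_of_digits (rcons s d).
  by apply: num_of_digits_gt0 => //; case: (s).
have head_s : head 1 s != 0 by case: (s) head_neq0.
move: num_gt0; rewrite num_of_digits_rcons rev_rcons => num_gt0.
case: fuel => [|fuel] le_fuel /=; first by lia.
rewrite ifF; last by lia.
rewrite modnMDl modn_small // divnMDl // divn_small // addn0 IHs //.
by lia.
Qed.

Lemma decimal_digits_num_of_digits s :
  all (gtn 10) s -> head 1 s != 0 -> decimal_digits (num_of_digits s) = s.
Proof.
by move=> s_lt10 s_head; rewrite /decimal_digits digits_le_aux_num_of_digits ?revK.
Qed.

(** * Repunits and strings with one changed digit *)

Lemma repunit9 n : 9 * repunit n + 1 = 10 ^ n.
Proof.
suff [m Em] : exists m, 10 ^ n = 9 * m + 1.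
  by rewrite /repunit Em addnK mulKn.
elim: n => [|n [m IHn]]; first by exists 0.
by exists (10 * m + 1); rewrite expnS IHn; lia.
Qed.

Lemma repunitS n : repunit n.+1 = 10 * repunit n + 1.
Proof. by have := repunit9 n; have := repunit9 n.+1; rewrite expnS; lia. Qed.

Lemma repunitD m n : repunit (m + n) = repunit m + 10 ^ m * repunit n.
Proof.
by have := repunit9 m; have := repunit9 n; have := repunit9 (m + n); rewrite expnD; nia.
Qed.

Lemma num_of_digits_nseq n a : num_of_digits (nseq n a) = a * repunit n.
Proof.
elim: n => [|n IHn]; first by rewrite muln0.
by rewrite -addn1 nseqD cats1 num_of_digits_rcons IHn addn1 repunitS; lia.
Qed.

(** The term [a * 10 ^ k] stands on the left because [b - a] may be negative. *)
Lemma num_of_digits_one_changed m k a b :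
  num_of_digits (nseq m a ++ b :: nseq k a) + a * 10 ^ k =
  a * repunit (m + k.+1) + b * 10 ^ k.
Proof.
rewrite num_of_digits_cat -cat1s num_of_digits_cat /= !num_of_digits_nseq size_nseq.
have -> : num_of_digits [:: b] = b by [].
have -> : m + k.+1 = k + 1 + m by lia.
by rewrite !repunitD (_ : repunit 1 = 1) // addn1 !mulnDr; lia.
Qed.

Lemma repunit_le_num_of_digits m k a b : 0 < a -> 0 < b ->
  repunit (m + k.+1) <= num_of_digits (nseq m a ++ b :: nseq k a).
Proof.
move=> a_gt0 b_gt0.
(* With both digits 1 the string is the repunit, so the bound follows digit by digit. *)
have E := num_of_digits_one_changed m k 1 1.
rewrite !mul1n in E; move/addIn: E => <-.
rewrite !num_of_digits_cat /= -![_ :: nseq k _]cat1s !num_of_digits_cat.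
rewrite !num_of_digits_nseq !size_nseq -[num_of_digits [:: 1]]/1.
rewrite -[num_of_digits [:: b]]/b.
by rewrite !(leq_add, leq_mul).
Qed.

Lemma decimal_digits_B n a b : 0 < n -> 0 < a < 10 -> 0 < b < 10 ->
  decimal_digits (B n a b) = nseq n.-1 a ++ [:: b].
Proof.
move=> n_gt0 a_bd b_bd.
have -> : B n a b = num_of_digits (nseq n.-1 a ++ [:: b]).
  have := num_of_digits_one_changed n.-1 0 a b.
  by rewrite /B /= addn1 prednK //; lia.
apply: decimal_digits_num_of_digits; last by case: (n.-1) => /=; lia.
by rewrite all_cat all_nseq /=; lia.
Qed.

(** Otherwise [d] would divide the permutation with [b] at place [k], and properly, since that
    number is at least [repunit n]. *)
Lemma absolute_prime_B_indivisible n a b k d :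
  0 < a < 10 -> 0 < b < 10 -> absolute_prime (B n a b) -> k < n ->
  1 < d < repunit n -> a * repunit n + b * 10 ^ k != a * 10 ^ k %[mod d].
Proof.
move=> a_bd b_bd [_ B_abs] lt_kn /andP[d_gt1 d_lt].
have n_gt0 : 0 < n by lia.
pose m := n - k.+1; have En : m + k.+1 = n by rewrite /m; lia.
set q := num_of_digits (nseq m a ++ b :: nseq k a).
have q_prime : prime q.
  apply: B_abs; rewrite decimal_digits_B // perm_sym perm_catC /=.
  rewrite perm_sym perm_catC /= perm_cons -nseqD.
  by have -> : k + m = n.-1 by lia.
have q_ge : repunit n <= q.
  by rewrite -En; apply: repunit_le_num_of_digits; lia.
rewrite -{1}En -num_of_digits_one_changed -/q -[X in _ != X %[mod d]]add0n.
rewrite eqn_modDr mod0n; apply/negP => d_dvd.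
by move/primeP: q_prime => [_ /(_ d d_dvd)] /orP[] /eqP; lia.
Qed.

(** * Divisibility tests depending on [n] modulo a period *)

(** Reduced modulo [d] at every step, so that they compute although [10 ^ n] is
    far too large in unary. *)
Definition repunit_mod d n := iter n (fun x => (10 * x + 1) %% d) 0.
Definition exp10_mod d k := iter k (fun x => 10 * x %% d) 1.

Lemma repunit_modE d n : repunit_mod d n = repunit n %[mod d].
Proof.
elim: n => // n IHn; rewrite /= modn_mod repunitS.
by rewrite -modnDml -modnMmr IHn modnMmr modnDml.
Qed.

Lemma exp10_modE d k : exp10_mod d k = 10 ^ k %[mod d].
Proof. by elim: k => // k IHk; rewrite /= modn_mod expnS -modnMmr IHk modnMmr. Qed.

(** For [k < n]: [d] divides the number with [b] at place [k] and [a] at the other [n - 1]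
    places. *)
Definition hits a b d n k :=
  a * repunit_mod d n + b * exp10_mod d k == a * exp10_mod d k %[mod d].

Lemma hitsE a b d n k :
  hits a b d n k = (a * repunit n + b * 10 ^ k == a * 10 ^ k %[mod d]).
Proof.
rewrite /hits -modnDm -[a * repunit_mod _ _ %% d]modnMmr -[b * _ %% d]modnMmr.
rewrite -[a * exp10_mod _ _ %% d]modnMmr repunit_modE exp10_modE.
by rewrite !modnMmr modnDm.
Qed.

(** Since [d] divides [repunit p], the residue of [repunit n] depends only on [n %% p]; the place
    [k] is untouched. *)
Lemma hits_periodic a b d p n k : repunit_mod d p %% d = 0 ->
  hits a b d (n %% p) k = hits a b d n k.
Proof.
rewrite !hitsE repunit_modE => p0; rewrite [in RHS](divn_eq n p) addnC.
suff E : repunit (n %/ p * p + n %% p) = repunit (n %% p) %[mod d].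
  by rewrite addnC -modnDm -modnMmr -E modnMmr modnDm addnC.
rewrite addnC; elim: (n %/ p) => [|q IHq]; first by rewrite addn0.
rewrite mulSn addnCA addnC repunitD.
by rewrite -modnDmr -modnMmr p0 muln0 mod0n addn0 IHq.
Qed.

Lemma ltn_exp10_repunit m n : m.+1 < n -> 10 ^ m.+1 < repunit n.
Proof.
move=> lt_mn; have := repunit9 n; have : 10 ^ m.+2 <= 10 ^ n by rewrite leq_exp2l.
have : 0 < 10 ^ m by rewrite expn_gt0.
by rewrite !expnS; lia.
Qed.

Lemma absolute_prime_B_not_hits n a b : 3 < n ->
  0 < a < 10 -> 0 < b < 10 -> absolute_prime (B n a b) ->
  forall d k, k < n -> 1 < d < 100 -> hits a b d n k = false.
Proof.
move=> n_gt3 a_bd b_bd B_abs d k lt_kn d_bd; apply/negbTE; rewrite hitsE.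
apply: absolute_prime_B_indivisible => //.
by have := @ltn_exp10_repunit 1 n; rewrite -[10 ^ 2]/100; lia.
Qed.

Lemma dvdn_expnD1_odd x m : odd m -> x + 1 %| x ^ m + 1.
Proof.
(* Zero is set apart because [x * x - 1] below would be truncated. *)
have [-> | x_gt0] := posnP x; first by rewrite dvd1n.
move=> m_odd; have -> : m = (m./2).*2.+1 by rewrite -[LHS]odd_double_half m_odd.
elim: (m./2) => [|i IHi]; first by rewrite expn1.
have -> : x ^ i.+1.*2.+1 + 1 = x * x * (x ^ i.*2.+1 + 1) - (x * x - 1).
  rewrite doubleS [x ^ i.*2.+3]expnS [x ^ i.*2.+2]expnS.
  by move: (x ^ _) => u; nia.
apply: dvdn_sub; first by rewrite dvdn_mull.
by rewrite mulnn -[1 in X in _ %| X](exp1n 2) subn_sqr dvdn_mull.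
Qed.

(** The last condition treats the [n] below [p], for which [k < p] does not give
    [k < n], by searching for a divisor less than 30. *)
Lemma absolute_prime_B_sieve n a b d p c (s : seq nat) : 3 < n ->
  0 < a < 10 -> 0 < b < 10 -> absolute_prime (B n a b) ->
  1 < d < 100 -> 0 < p -> c %| p -> repunit_mod d p %% d = 0 ->
  all (fun r => (r %% c \in s) ==> has (hits a b d r) (iota 0 p)) (iota 0 p) ->
  all (fun m => (m %% c \in s) ==>
        has (fun e => has (hits a b e m) (iota 0 m)) (iota 2 28)) (iota 4 (p - 4)) ->
  n %% c \notin s.
Proof.
move=> n_gt3 a_bd b_bd B_abs d_bd p_gt0 c_dvd d_per /allP large /allP small.
have hit := absolute_prime_B_not_hits n_gt3 a_bd b_bd B_abs.
apply/negP => n_s; have [le_pn | lt_np] := leqP p n.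
  (* Here every place [k < p] exists in the number, and [n] may be replaced by its residue. *)
  have /hasP[k] : has (hits a b d (n %% p)) (iota 0 p).
    apply: (implyP (large _ _)); first by rewrite mem_iota ltn_mod.
    by rewrite modn_dvdm.
  by rewrite mem_iota hits_periodic // => lt_kp; rewrite hit //; lia.
have /hasP[e e_bd /hasP[k]] :
    has (fun e => has (hits a b e n) (iota 0 n)) (iota 2 28).
  by apply: (implyP (small n _)); rewrite ?mem_iota //; lia.
by move: e_bd; rewrite !mem_iota => e_bd lt_kn; rewrite hit //; lia.
Qed.

(** * Exclusion of the six pairs *)

Lemma absolute_prime_B17_dvd3 n : 3 < n -> absolute_prime (B n 1 7) -> 3 %| n.
Proof.
move=> n_gt3 B_abs.
suff: n %% 3 \notin [:: 1; 2] by rewrite !inE; lia.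
by apply: (@absolute_prime_B_sieve n 1 7 7 6); vm_compute.
Qed.

Lemma absolute_prime_B71_dvd3 n : 3 < n -> absolute_prime (B n 7 1) -> 3 %| n.
Proof.
move=> n_gt3 B_abs.
suff: n %% 3 \notin [:: 1; 2] by rewrite !inE; lia.
(* The modulus 7 is useless here: the permuted numbers are [10 ^ k] modulo 7, never 0. *)
by apply: (@absolute_prime_B_sieve n 7 1 19 18); vm_compute.
Qed.

Lemma absolute_prime_B97_dvd3 n : 3 < n -> absolute_prime (B n 9 7) -> 3 %| n.
Proof.
move=> n_gt3 B_abs.
suff: n %% 3 \notin [:: 1; 2] by rewrite !inE; lia.
by apply: (@absolute_prime_B_sieve n 9 7 7 6); vm_compute.
Qed.

Lemma absolute_prime_B91_even n : 3 < n -> absolute_prime (B n 9 1) -> ~~ odd n.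
Proof.
move=> n_gt3 B_abs.
suff: n %% 2 \notin [:: 1] by rewrite !inE modn2; case: odd.
by apply: (@absolute_prime_B_sieve n 9 1 7 6); vm_compute.
Qed.

(* [2 * a] stands for [- a] modulo 3. *)
Lemma not_absolute_prime_B_dvd3 n a b : 3 < n -> 0 < a < 10 -> 0 < b < 10 ->
  3 %| a * n + b + 2 * a -> ~ absolute_prime (B n a b).
Proof.
move=> n_gt3 a_bd b_bd dvd3 /(absolute_prime_B_not_hits n_gt3 a_bd b_bd) hit.
have := hit 3 0 (ltnW (ltnW (ltnW n_gt3))) isT.
rewrite hitsE !muln1 -(eqn_modDr (2 * a)) -addnA -modnDml -modnMmr.
have -> : repunit n = n %[mod 3].
  by elim: (n) => // m IHm; rewrite repunitS; lia.
by rewrite modnMmr modnDml addnA (eqP dvd3); lia.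
Qed.

Lemma not_absolute_prime_B97 n : 3 < n -> 3 %| n -> ~ absolute_prime (B n 9 7).
Proof.
move=> n_gt3 n_dvd3 B_abs.
pose k := 2 ^ logn 2 n; have n_gt0 : 0 < n by lia.
have k_gt0 : 0 < k by rewrite expn_gt0.
have En : n = n %/ k * k by rewrite divnK // pfactor_dvdnn.
have m_odd : odd (n %/ k).
  have := pfactor_coprime (isT : prime 2) n_gt0 => -[m m_odd Em].
  by rewrite {1}Em mulnK // -coprime2n.
have m_neq1 : n %/ k != 1.
  (* Otherwise [n] is a power of 2, which 3 does not divide. *)
  apply/eqP => m1; move: n_dvd3; by rewrite En m1 mul1n Euclid_dvdX.
(* The quotient is at least 3, so [n >= 3 * k >= k + 2]; this keeps [10 ^ k + 1] below
   [repunit n]. *)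
have lt_kn : k.+1 < n by nia.
suff : 9 * repunit n + 7 * 10 ^ k = 9 * 10 ^ k %[mod 10 ^ k + 1].
  apply/eqP; apply: absolute_prime_B_indivisible => //; first by lia.
  have := @ltn_exp10_repunit k n lt_kn.
  have : 0 < 10 ^ k by rewrite expn_gt0.
  by rewrite expnS; lia.
(* Adding twice the modulus avoids subtraction and brings out [10 ^ n + 1]. *)
apply/eqP; rewrite -(eqn_modDr (2 * (10 ^ k + 1))).
have -> : 9 * repunit n + 7 * 10 ^ k + 2 * (10 ^ k + 1)
        = 9 * 10 ^ k + ((10 ^ k) ^ (n %/ k) + 1).
  by rewrite -expnM [k * _]mulnC -En -(repunit9 n); lia.
rewrite eqn_modDl modnMl.
exact: dvdn_expnD1_odd.
Qed.

Lemma not_absolute_prime_B91 n : 3 < n -> ~~ odd n -> ~ absolute_prime (B n 9 1).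
Proof.
move=> n_gt3 n_even B_abs.
have En : n = n./2 + n./2 by rewrite addnn even_halfK.
case Em : n./2 => [|[|m]]; try lia.
(* This makes the divisor [10 ^ n./2 - 3] an exact difference greater than 1. *)
have x_gt : 9 < 10 ^ n./2 by rewrite Em !expnS; have := expn_gt0 10 m; lia.
suff : 9 * repunit n + 1 * 10 ^ 0 = 9 * 10 ^ 0 %[mod 10 ^ n./2 - 3].
  apply/eqP; apply: absolute_prime_B_indivisible => //; first by lia.
  have lt_mn : (m.+1).+1 < n by lia.
  by have := @ltn_exp10_repunit m.+1 n lt_mn; rewrite -Em; lia.
apply/eqP; rewrite mul1n repunit9 muln1 eqn_mod_dvd.
  by rewrite {2}En expnD mulnn -[9]/(3 ^ 2) subn_sqr dvdn_mulr.
by rewrite {1}En expnD; nia.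
Qed.

Theorem theorem3 (n a b : nat) :
  3 < n ->
  a \in [:: 1; 3; 7; 9] -> b \in [:: 1; 3; 7; 9] -> a != b ->
  absolute_prime (B n a b) ->
  (a, b) \notin [:: (9, 7); (9, 1); (1, 7); (7, 1); (3, 9); (9, 3)].
Proof.
move=> n_gt3 _ _ _ B_abs; rewrite !inE.
apply/negP => /or4P[|||/or3P[]] /eqP[Ea Eb]; rewrite {}Ea {}Eb in B_abs.
- exact: (not_absolute_prime_B97 n_gt3 (absolute_prime_B97_dvd3 n_gt3 B_abs)).
- exact: (not_absolute_prime_B91 n_gt3 (absolute_prime_B91_even n_gt3 B_abs)).
- have n3 := absolute_prime_B17_dvd3 n_gt3 B_abs.
  by apply: not_absolute_prime_B_dvd3 B_abs => //; lia.
- have n3 := absolute_prime_B71_dvd3 n_gt3 B_abs.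
  by apply: not_absolute_prime_B_dvd3 B_abs => //; lia.
- by apply: not_absolute_prime_B_dvd3 B_abs => //; lia.
- by apply: not_absolute_prime_B_dvd3 B_abs => //; lia.
Qed.
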